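(* A positive proportion of the Gaussian integers $\zeta \in \mathbb{Z}[i]$ with odd norm $\mathcal{N}(\zeta)$ are not of the form $\varpi+(1+i)^k$ with $k \in \mathbb{N}_0$ and $\varpi$ a prime element of $\mathbb{Z}[i]$. That is, $$\liminf_{x\to\infty}\frac{\#\{\zeta\in\mathbb{Z}[i]:\ |\zeta|\le x,\ \mathcal{N}(\zeta)\text{ odd},\ \zeta\ne\varpi+(1+i)^k \text{ for all Gaussian primes } \varpi \text{ and all } k\in\mathbb{N}_0\}}{\#\{\zeta\in\mathbb{Z}[i]:\ |\zeta|\le x,\ \mathcal{N}(\zeta)\text{ odd}\}}>0.$$
   Context: $\mathcal{N}(a+bi)=a^2+b^2$ is the norm on $\mathbb{Z}[i]$, $|\cdot|$ is the complex absolute value, $\mathbb{N}_0$ is the set of non-negative integers, and Gaussian primes are all prime elements of $\mathbb{Z}[i]$ (including all associates). *)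

(* Defs.v *)
From HB Require Import structures.
From mathcomp Require Import all_boot all_order all_algebra.
From mathcomp Require Import ring lra zify.
From mathcomp Require Import finmap.
From mathcomp Require Import all_classical all_reals all_analysis.

Set Implicit Arguments.
Unset Strict Implicit.
Unset Printing Implicit Defensive.

Import Order.TTheory GRing.Theory Num.Theory.
Import numFieldNormedType.Exports.
From mathcomp Require Import complex.

Local Open Scope classical_set_scope.
Local Open Scope ring_scope.
Local Open Scope complex_scope.

(* The library makes [R[i]] a ring only when [R] is a field, so Z[i] is an
   alias of [int[i]] that carries its own ring structure, with the library's
   multiplication [mulc]. *)
Definition gaussInt : Type := int[i].

HB.instance Definition _ := GRing.Zmodule.on gaussInt.

Fact gauss_mul1 : left_id (1 +i* 0 : gaussInt) (@ComplexField.mulc int).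
Proof. by case=> a b /=; rewrite !mul1r !mul0r subr0 addr0. Qed.

Fact gauss_mulDl :
  left_distributive (@ComplexField.mulc int) (+%R : gaussInt -> _ -> _).
Proof. by case=> [a b] [c d] [e f]; congr (_ +i* _); ring. Qed.

Fact gauss_1_neq0 : (1 +i* 0 : gaussInt) != 0.
Proof. by []. Qed.

HB.instance Definition _ := GRing.Zmodule_isComNzRing.Build gaussInt
  (@ComplexField.mulcA int) (@ComplexField.mulcC int)
  gauss_mul1 gauss_mulDl gauss_1_neq0.

Definition gauss_norm (z : gaussInt) : int := Re z ^+ 2 + Im z ^+ 2.

Lemma gauss_normM (x y : gaussInt) :
  gauss_norm (x * y) = gauss_norm x * gauss_norm y.
Proof. by case: x y => [a b] [c d]; rewrite /gauss_norm /=; ring. Qed.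

Lemma gauss_norm_ge0 (x : gaussInt) : 0 <= gauss_norm x.
Proof. by rewrite addr_ge0 ?sqr_ge0. Qed.

Lemma gauss_norm_eq0 (x : gaussInt) : (gauss_norm x == 0) = (x == 0).
Proof.
case: x => a b; rewrite /gauss_norm /= paddr_eq0 ?sqr_ge0 //.
by rewrite !sqrf_eq0 eq_complex.
Qed.

Definition gauss_unit : pred gaussInt := fun z => gauss_norm z == 1.

Definition gauss_inv (z : gaussInt) : gaussInt :=
  if gauss_unit z then Re z -i* Im z else z.

Fact gauss_mulVx : {in gauss_unit, left_inverse 1 gauss_inv *%R}.
Proof.
move=> z zu; have {}zu : gauss_unit z by [].
rewrite /gauss_inv zu; move: zu; case: z => a b /eqP.
by rewrite /gauss_norm /= => h; congr (_ +i* _); [rewrite -h|]; ring.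
Qed.

Fact gauss_unitPl (x y : gaussInt) : y * x = 1 -> gauss_unit x.
Proof.
move=> /(congr1 gauss_norm); rewrite gauss_normM /gauss_unit.
rewrite [RHS](_ : _ = 1) //.
move: (gauss_norm_ge0 x) (gauss_norm_ge0 y).
case: (gauss_norm x) (gauss_norm y) => [m|//] [n|//] _ _ /eqP.
by rewrite -PoszM eqz_nat muln_eq1 => /andP[_ /eqP ->].
Qed.

Fact gauss_inv_out : {in [predC gauss_unit], gauss_inv =1 id}.
Proof. move=> z zu; have {}zu : ~~ gauss_unit z by [].
by rewrite /gauss_inv (negbTE zu). Qed.

HB.instance Definition _ := GRing.ComNzRing_hasMulInverse.Build gaussInt
  gauss_mulVx gauss_unitPl gauss_inv_out.

Fact gauss_mulf_eq0 : GRing.integral_domain_axiom gaussInt.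
Proof.
move=> x y /eqP; rewrite -gauss_norm_eq0 gauss_normM mulf_eq0.
by rewrite !gauss_norm_eq0.
Qed.

HB.instance Definition _ :=
  GRing.ComUnitRing_isIntegral.Build gaussInt gauss_mulf_eq0.

Definition gauss_i : gaussInt := 0 +i* 1.

Definition gauss_complex (R : realType) (z : gaussInt) : R[i] :=
  (Re z)%:~R +i* (Im z)%:~R.

(* The library norm [`|z|] of [z : R[i]] lives in [R[i]]; [normc] is the same
   absolute value as an element of [R]. *)
Definition gauss_abs (R : realType) (z : gaussInt) : R :=
  Normc.normc (gauss_complex R z).

Definition divides (A : comUnitRingType) (a b : A) : Prop :=
  exists c, b = a * c.

Definition prime_element (A : comUnitRingType) (p : A) : Prop :=
  [/\ p != 0, p \isn't a GRing.unit &
      forall a b, divides p (a * b) -> divides p a \/ divides p b].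

Definition odd_norm : set gaussInt := [set z | odd `|gauss_norm z|%N].

Definition prime_plus_power : set gaussInt :=
  [set z | exists (p : gaussInt) (k : nat),
             prime_element p /\ z = p + (1 + gauss_i) ^+ k].

(* [fset_set] is [fset0] on infinite sets; see [finite_gauss_disc]. *)
Definition count_upto (R : realType) (A : set gaussInt) (x : R) : nat :=
  #|` fset_set (A `&` [set z | gauss_abs R z <= x]) |.

Lemma finite_gauss_disc (R : realType) (x : R) :
  finite_set [set z : gaussInt | gauss_abs R z <= x].
Proof.
pose n := Num.truncn x.
pose f (p : 'I_(2 * n).+1 * 'I_(2 * n).+1) : gaussInt :=
  (p.1%:Z - n%:Z) +i* (p.2%:Z - n%:Z).
apply: (@sub_finite_set _ _ (f @` setT)); last first.
  by apply: finite_image; exact: finite_finset.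
have bnd (a b : int) : Num.sqrt (a%:~R ^+ 2 + b%:~R ^+ 2 : R) <= x ->
    (`|a| <= n)%N.
  move=> h; rewrite truncn_ge_nat; last exact: le_trans (sqrtr_ge0 _) h.
  apply: le_trans h; rewrite natr_absz intr_norm -sqrtr_sqr ler_wsqrtr //.
  by rewrite lerDl sqr_ge0.
case=> a b /= h; have ha := bnd a b h.
have hb : (`|b| <= n)%N by apply: (bnd b a); rewrite addrC.
have la : (`|(a + n%:Z)%R| < (2 * n).+1)%N by lia.
have lb : (`|(b + n%:Z)%R| < (2 * n).+1)%N by lia.
by exists (Ordinal la, Ordinal lb) => //; rewrite /f /=; congr (_ +i* _); lia.
Qed.

(* Main.v *)
Require Import Defs.
From mathcomp Require Import all_boot all_order all_algebra.
From mathcomp Require Import ring zify.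
From mathcomp Require Import finmap.
From mathcomp Require Import all_classical all_reals all_analysis.

(** The proof follows Erdos's covering argument, carried over to the base
[1 + i].  Six residue classes cover the natural numbers ([covering]):
[0 mod 2], [1 mod 3], [3 mod 4], [5 mod 8], [9 mod 12] and [17 mod 24].  To
each class [r mod m] corresponds a Gaussian prime [d] modulo which [1 + i] has
order [m]; in the same order these are [2 + i], [2 + 3i], [1 + 2i], [3],
[3 + 2i] and [7].  By the Chinese remainder theorem some [c] satisfies
[c = (1 + i)^r mod d] for all six pairs, and then, for every [zeta] congruent
to [c] modulo the product [1365] of the six primes (up to units) and for every
[k], one of the six divides [zeta - (1 + i)^k] ([progression_divisor]).

If moreover [zeta = p + (1 + i)^k] with [p] prime, then [p] is associated to
one of the six primes, so its norm is at most 49 and its real part lies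
between -7 and 7.  A further congruence modulo 16 makes this impossible.  The
representative [c = -136 + 179i] has real part [8 mod 16].  As
[(1 + i)^8 = 16], for [k >= 8] the real part of [p] would be [8 mod 16], which
is too large; and for [k < 8] the real part of [zeta] would lie between -15
and 15, whereas it is [-136 mod 21840], with [21840 = 16 * 1365]
([progression_not_prime_plus_power]).  Since [c] has odd norm, so has every
[zeta] congruent to it modulo 21840.

It remains that a translate [c + m Z[i]] has positive lower density among all
Gaussian integers.  Crude bounds by squares suffice.  A disc of radius [x]
holds at most [(2 x + 1)^2] Gaussian integers.  If the coordinates of [c] are
at most [m] in absolute value, the disc contains all [c + m (u + v i)] with
natural numbers [u] and [v] below [floor (x / (2 m))]
([count_upto_progression], [lower_density_gt0]). *)

Set Implicit Arguments.
Unset Strict Implicit.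
Unset Printing Implicit Defensive.

Import Order.TTheory GRing.Theory Num.Theory.
Import numFieldNormedType.Exports.
From mathcomp Require Import complex.

Local Open Scope classical_set_scope.
Local Open Scope ring_scope.
Local Open Scope complex_scope.

(** * Divisors of differences of powers *)

Lemma divides_exprB (A : comUnitRingType) (d x : A) (m r k : nat) :
  divides d (x ^+ m - 1) -> (k %% m)%N = r -> divides d (x ^+ k - x ^+ r).
Proof.
move=> [e he] kr; rewrite {1}(divn_eq k m) kr exprD mulnC exprM.
rewrite -[X in _ - X]mul1r -mulrBl subrX1 he.
by eexists; rewrite -!mulrA.
Qed.

(** Primes are irreducible: in [p = d * q] the prime [p] divides [d] or [q], and
[q = p * r] would give [d * r = 1]. *)
Lemma prime_divisor_assoc (A : idomainType) (d p : A) :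
  prime_element p -> d \isn't a GRing.unit -> divides d p -> divides p d.
Proof.
move=> [p0 _ pP] dU [q pq].
case: (pP d q) => // [|[r qr]]; first by exists 1; rewrite mulr1.
case/negP: dU; apply/unitrPr; exists r; apply: (mulfI p0).
by rewrite mulr1 mulrCA -qr -pq.
Qed.

Lemma gauss_norm_divides (p d : gaussInt) :
  d != 0 -> divides p d -> gauss_norm p <= gauss_norm d.
Proof.
move=> d0 [q dq]; move: d0; rewrite dq mulf_eq0 negb_or => /andP[_ q0].
rewrite gauss_normM ler_peMr ?gauss_norm_ge0 //.
by rewrite -gtz0_ge1 lt_def gauss_norm_eq0 q0 gauss_norm_ge0.
Qed.

(** * An arithmetic progression avoiding primes plus powers *)

(** The residue class of [-136 + 179i] modulo [21840 = 16 * 3 * 5 * 7 * 13]. *)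
Definition progression (u v : int) : gaussInt :=
  (-136 + 21840 * u) +i* (179 + 21840 * v).

Lemma progressionE (u v : int) :
  progression u v =
  progression 0 0 + (21840 +i* 0 : gaussInt) * (u +i* v : gaussInt).
Proof.
have splitM (M a b : int) : (a + M * u) +i* (b + M * v) =
    ((a + M * 0) +i* (b + M * 0) : gaussInt) + (M +i* 0 : gaussInt) * (u +i* v).
  by congr (_ +i* _); ring.
(* Through a variable modulus, [ring] never meets the unary numeral 21840. *)
exact: splitM.
Qed.

(** The classes modulo 2, 4 and 8 leave [1 mod 8], that is 1, 9 and 17 modulo
24; the classes modulo 3, 12 and 24 take one each. *)
Lemma covering (k : nat) :
  [|| k %% 2 == 0, k %% 3 == 1, k %% 4 == 3,
      k %% 8 == 5, k %% 12 == 9 | k %% 24 == 17]%N.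
Proof. lia. Qed.

(** One class [r mod m] of the covering: modulo [d], the power [(1 + i)^k]
depends only on [k mod m], and the progression is constant.  The cofactors
[e], [f], [g] are arguments so that each instance is a mere computation. *)
Lemma progression_divides (d e f g : gaussInt) (m r k : nat) (u v : int) :
  (k %% m)%N = r ->
  (1 + gauss_i) ^+ m - 1 = d * e ->
  progression 0 0 - (1 + gauss_i) ^+ r = d * f ->
  21840 +i* 0 = d * g ->
  divides d (progression u v - (1 + gauss_i) ^+ k).
Proof.
move=> kr he hf hg.
have [h hh] : divides d ((1 + gauss_i) ^+ k - (1 + gauss_i) ^+ r).
  by apply: divides_exprB kr; exists e.
exists (f + g * (u +i* v : gaussInt) - h).
rewrite mulrBr mulrDr mulrA -hf -hg -hh progressionE.
have regroup (a b s t : gaussInt) : a + b - s = a - t + b - (s - t) by ring.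
exact: regroup.
Qed.

Lemma progression_divisor (u v : int) (k : nat) :
  exists2 d : gaussInt, 1 < gauss_norm d <= 49 &
    divides d (progression u v - (1 + gauss_i) ^+ k).
Proof.
have := covering k.
(* In each case the three explicit cofactors are the quotients by [d] of
   [(1 + i)^m - 1], [c - (1 + i)^r] and 21840. *)
case/or4P=> [||| /or3P[]] /eqP kr.
- exists (2 +i* 1) => //.
  by apply: (@progression_divides _ (0 +i* 1) (-19 +i* 99) (8736 -i* 4368)
    _ _ _ _ _ kr); vm_compute.
- exists (2 +i* 3) => //.
  by apply: (@progression_divides _ (0 +i* 1) (20 +i* 59) (3360 -i* 5040)
    _ _ _ _ _ kr); vm_compute.
- exists (1 +i* 2) => //.
  by apply: (@progression_divides _ (-1 +i* 2) (44 +i* 89) (4368 -i* 8736)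
    _ _ _ _ _ kr); vm_compute.
- exists (3 +i* 0) => //.
  by apply: (@progression_divides _ (5 +i* 0) (-44 +i* 61) (7280 +i* 0)
    _ _ _ _ _ kr); vm_compute.
- exists (3 +i* 2) => //.
  by apply: (@progression_divides _ (-15 +i* 10) (-10 +i* 61) (5040 -i* 3360)
    _ _ _ _ _ kr); vm_compute.
- exists (7 +i* 0) => //.
  by apply: (@progression_divides _ (585 +i* 0) (-56 -i* 11) (3120 +i* 0)
    _ _ _ _ _ kr); vm_compute.
Qed.

(** A consequence of [(1 + i)^8 = 16]; below 8 the powers are small. *)
Lemma Re_expr_1i (k : nat) :
  let a := Re ((1 + gauss_i) ^+ k) in
  (-8 <= a <= 8) \/ exists b : int, a = 16 * b.
Proof.
case: (ltnP k 8) => [|/subnKC <- /=].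
  by do 8 (case: k => [|k]; first by left).
right; exists (Re ((1 + gauss_i) ^+ (k - 8))).
rewrite exprD (_ : (1 + gauss_i) ^+ 8 = 16 +i* 0); last by vm_compute.
by case: (_ ^+ (k - 8)) => a b /=; ring.
Qed.

Lemma progression_not_prime_plus_power (u v : int) :
  ~ prime_plus_power (progression u v).
Proof.
case=> p [k [pP zE]].
have [d /andP[d1 d49]] := progression_divisor u v k.
rewrite zE addrK => /(prime_divisor_assoc pP) dp.
have dU : d \isn't a GRing.unit by apply/negP => /eqP dN; rewrite dN in d1.
have d0 : d != 0 by apply/eqP => dE; rewrite dE in d1.
have := le_trans (gauss_norm_divides d0 (dp dU)) d49.
have : -136 + 21840 * u = Re p + Re ((1 + gauss_i) ^+ k).
  by have := congr1 (@Re _) zE; case: (p) ((1 + gauss_i) ^+ k) => [? ?] [? ?].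
case: (p) => a b; rewrite /gauss_norm /= => aE nle.
have a7 : -7 <= a <= 7 by nia.
(* The real part [-136 + 21840 * u] is neither in [-15, 15] nor within 7 of a
   multiple of 16. *)
case: (Re_expr_1i k) => /= [|[c cE]]; lia.
Qed.

Lemma odd_norm_even_odd (a b : int) :
  odd_norm ((2 * a) +i* (2 * b + 1) : gaussInt).
Proof.
rewrite /odd_norm /= (_ : gauss_norm _ = 1 + 2 * (2 * (a ^+ 2 + b ^+ 2 + b))).
  lia.
by rewrite /gauss_norm /=; ring.
Qed.

Lemma progression_odd (u v : int) : odd_norm (progression u v).
Proof.
have Re2 : -136 + 21840 * u = 2 * (-68 + 10920 * u) by lia.
have Im2 : 179 + 21840 * v = 2 * (89 + 10920 * v) + 1 by lia.
by rewrite /progression Re2 Im2; apply: odd_norm_even_odd.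
Qed.

(** * Counting in discs *)

Lemma count_upto_le_card (R : realType) (A : set gaussInt) (x : R)
    (I : finType) (g : I -> gaussInt) :
  (forall z, gauss_abs R z <= x -> exists i, z = g i) ->
  (count_upto A x <= #|I|)%N.
Proof.
move=> gP; have fin : finite_set (A `&` [set z | gauss_abs R z <= x]).
  by apply: sub_finite_set (finite_gauss_disc x) => z [].
rewrite /count_upto.
apply: (@leq_trans #|` [fset g i | i in I]%fset|); last first.
  by rewrite (leq_trans (leq_imfset_card _ _ _)) // cardE.
apply/fsubset_leq_card/fsubsetP => z; rewrite in_fset_set // inE => -[_ /= zx].
by apply/imfsetP; have [i ->] := gP z zx; exists i.
Qed.

Lemma card_le_count_upto (R : realType) (A : set gaussInt) (x : R)
    (I : finType) (g : I -> gaussInt) :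
  injective g -> (forall i, A (g i)) -> (forall i, gauss_abs R (g i) <= x) ->
  (#|I| <= count_upto A x)%N.
Proof.
move=> gI gA gx; have fin : finite_set (A `&` [set z | gauss_abs R z <= x]).
  by apply: sub_finite_set (finite_gauss_disc x) => z [].
rewrite /count_upto.
have <- : #|` [fset g i | i in I]%fset| = #|I| by rewrite card_imfset //= cardE.
apply/fsubset_leq_card/fsubsetP => z /imfsetP[i _ ->].
by rewrite in_fset_set //; apply: mem_set; split; [exact: gA | exact: gx].
Qed.

Lemma gauss_abs_le (R : realType) (a b : int) (n : nat) :
  (`|a| + `|b| <= n)%N -> gauss_abs R (a +i* b) <= n%:R.
Proof.
move=> abn; rewrite -[leRHS]ger0_norm // -sqrtr_sqr ler_wsqrtr //= pmulrn.
by rewrite -!rmorphXn -rmorphD /= ler_int; nia.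
Qed.

Lemma normz_Re_le (R : realType) (z : gaussInt) (x : R) :
  gauss_abs R z <= x -> (`|Re z| <= Num.truncn x)%N.
Proof.
case: z => a b /= zx.
rewrite truncn_ge_nat; last exact: le_trans (sqrtr_ge0 _) zx.
apply: le_trans zx; rewrite natr_absz intr_norm -sqrtr_sqr ler_wsqrtr //.
by rewrite lerDl sqr_ge0.
Qed.

Lemma normz_Im_le (R : realType) (z : gaussInt) (x : R) :
  gauss_abs R z <= x -> (`|Im z| <= Num.truncn x)%N.
Proof.
case: z => a b zx; apply: (@normz_Re_le R (b +i* a)).
by move: zx; rewrite /gauss_abs /= addrC.
Qed.

Lemma count_upto_le_square (R : realType) (A : set gaussInt) (x : R) :
  (count_upto A x <= (2 * Num.truncn x).+1 ^ 2)%N.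
Proof.
set n := Num.truncn x.
pose g (p : 'I_(2 * n).+1 * 'I_(2 * n).+1) : gaussInt :=
  (p.1%:Z - n%:Z) +i* (p.2%:Z - n%:Z).
have /(@count_upto_le_card R A x _ g) : forall z : gaussInt,
    gauss_abs R z <= x -> exists i, z = g i.
  move=> z zx; have := normz_Re_le zx; have := normz_Im_le zx.
  case: z {zx} => a b; rewrite -/n /= => bn an.
  have la : (`|(a + n%:Z)%R| < (2 * n).+1)%N by lia.
  have lb : (`|(b + n%:Z)%R| < (2 * n).+1)%N by lia.
  by exists (Ordinal la, Ordinal lb); congr (_ +i* _) => /=; lia.
by rewrite card_prod card_ord.
Qed.

(** The points with [u, v < n] have both coordinates at most [m * n] in absolute
value, hence lie in the disc of radius [2 * m * n]. *)
Lemma count_upto_ge_square (R : realType) (A : set gaussInt) (a b : int)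
    (m n : nat) (x : R) :
  (0 < m)%N -> (`|a| <= m)%N -> (`|b| <= m)%N ->
  (forall u v : nat, A ((a + m%:Z * u%:Z) +i* (b + m%:Z * v%:Z))) ->
  (2 * m * n)%:R <= x -> (n ^ 2 <= count_upto A x)%N.
Proof.
move=> m0 am bm AP mnx.
pose g (p : 'I_n * 'I_n) : gaussInt :=
  (a + m%:Z * p.1%:Z) +i* (b + m%:Z * p.2%:Z).
have /(@card_le_count_upto R A x _ g) : injective g.
  move=> [u v] [u' v'] [/addrI + /addrI]; have mz : m%:Z != 0 by lia.
  by move=> /(mulfI mz) [/val_inj ->] /(mulfI mz) [/val_inj ->].
rewrite card_prod card_ord -mulnn; apply => [[u v]|[u v]]; first exact: AP.
apply: le_trans mnx; apply: gauss_abs_le => /=.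
by move: (ltn_ord u) (ltn_ord v); nia.
Qed.

(** For [N = truncn x] and [n = N %/ (2 * m)], the bounds by squares are
[(2 * N + 1) ^ 2] above and [n ^ 2] below; as [n >= 1], also
[N < 2 * m * (n + 1) <= 4 * m * n], so [2 * N + 1 <= 12 * m * n]. *)
Lemma count_upto_progression (R : realType) (A B : set gaussInt) (a b : int)
    (m : nat) (x : R) :
  (0 < m)%N -> (`|a| <= m)%N -> (`|b| <= m)%N ->
  (forall u v : nat, A ((a + m%:Z * u%:Z) +i* (b + m%:Z * v%:Z))) ->
  (2 * m)%:R <= x ->
  (count_upto B x <= (12 * m) ^ 2 * count_upto A x)%N.
Proof.
move=> m0 am bm AP mx; have x0 : 0 <= x by apply: le_trans mx.
set N := Num.truncn x; have mN : (2 * m <= N)%N by rewrite truncn_ge_nat.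
pose n := (N %/ (2 * m))%N.
have n0 : (0 < n)%N by rewrite divn_gt0 // muln_gt0.
have nN : (2 * m * n <= N)%N by rewrite mulnC leq_divM.
have Nn : (N < 2 * m * n.+1)%N by rewrite mulnC ltn_ceil // muln_gt0.
have nA : (n ^ 2 <= count_upto A x)%N.
  by apply: (count_upto_ge_square m0 am bm AP); rewrite -truncn_ge_nat.
apply: leq_trans (count_upto_le_square B x) _.
apply: leq_trans (leq_mul (leqnn _) nA); rewrite -expnMn leq_exp2r // -/N.
by nia.
Qed.

Lemma lower_density_gt0 (R : realType) (A B : set gaussInt) (a b : int)
    (m : nat) :
  (0 < m)%N -> (`|a| <= m)%N -> (`|b| <= m)%N -> A `<=` B ->
  (forall u v : nat, A ((a + m%:Z * u%:Z) +i* (b + m%:Z * v%:Z))) ->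
  (0 < limf_einf
         (fun x : R => ((count_upto A x)%:R / (count_upto B x)%:R : R)%:E)
         (pinfty_nbhs R))%E.
Proof.
move=> m0 am bm AB AP.
have BP u v : B ((a + m%:Z * Posz u) +i* (b + m%:Z * Posz v)) by exact/AB/AP.
have m12 : (0 < (12 * m) ^ 2)%N by rewrite expn_gt0 muln_gt0 m0.
pose delta : R := (((12 * m) ^ 2)%:R)^-1.
have delta0 : 0 < delta by rewrite invr_gt0 ltr0n.
rewrite limf_einfE.
apply: (@lt_le_trans _ _ delta%:E); first by rewrite lte_fin.
apply: ereal_sup_ge.
exists (ereal_inf ((fun x : R =>
    ((count_upto A x)%:R / (count_upto B x)%:R : R)%:E)
   @` [set x | (2 * m)%:R <= x])).
  exists [set x | (2 * m)%:R <= x] => //.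
  by exists (2 * m)%:R; split; [exact: num_real | move=> x /ltW].
apply: le_ereal_inf_tmp => _ [x /= mx <-]; rewrite lee_fin.
have B0 : (0 < count_upto B x)%N.
  by apply: (count_upto_ge_square (n := 1) m0 am bm BP); rewrite muln1.
rewrite ler_pdivlMr ?ltr0n // mulrC ler_pdivrMr ?ltr0n //.
by rewrite mulrC -natrM ler_nat (count_upto_progression _ m0 am bm).
Qed.

Theorem theorem3 (R : realType) :
  (0 < limf_einf
         (fun x : R =>
            ((count_upto (odd_norm `&` ~` prime_plus_power) x)%:R /
             (count_upto odd_norm x)%:R : R)%:E)
         (pinfty_nbhs R))%E.
Proof.
(* Keeping [m] abstract prevents the unary numeral from being unfolded. *)
have [m mE] : exists m : nat, m%:Z = 21840 by exists 21840%N.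
apply: (@lower_density_gt0 R _ _ (-136) 179 m); [lia..| exact: subIsetl |].
move=> u v; rewrite mE; split; first exact: progression_odd.
exact: progression_not_prime_plus_power.
Qed.
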